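(* For the hyperbolic plane $\mathbb{H}^2$ we have $$\Gamma_{\mathbb{H}^2}(x) = x - \cosh^{-1}\left(\cosh^2\left(\frac{x}{2}\right)\right)\qquad\text{for all } x\in[0,\infty).$$ We also have $\Gamma_{\mathbb{H}^2}'(x) \geq 0$ and $\Gamma_{\mathbb{H}^2}''(x) \leq 0$ for all $x \in (0,\infty)$.
   Context: $\mathbb{H}^2$ is the hyperbolic plane: the complete, simply connected Riemannian surface of constant curvature $-1$, viewed as a metric space with its geodesic distance. $\cosh^{-1}:[1,\infty)\to[0,\infty)$ is the nonnegative inverse of $\cosh$. A quadruple $\square=\{a,b,c,d\}$ in a metric space $(X,d)$ is a choice of four (not necessarily distinct) points of $X$. Its three pairwise distance sums are $d(a,b)+d(c,d)$, $d(a,c)+d(b,d)$, $d(a,d)+d(b,c)$; label them so that $S\le M\le L$, and set $\delta(\square)=\frac{L-M}{2}$. The diameter $D(\square)$ is the largest distance between two points of $\square$. Let $\mathrm{Dist}_X=\{d(a,b):a,b\in X\}\subset[0,\infty)$, and define $\Gamma_X:\mathrm{Dist}_X\to\mathbb{R}$ by $$\Gamma_X(x)=\sup_{\square\subset X:\,D(\square)=x}\delta(\square).$$ For $X=\mathbb{H}^2$, $\mathrm{Dist}_X=[0,\infty)$. *)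

(* Defs.v *)
From Stdlib Require Import Reals Lra.
From Coquelicot Require Import Coquelicot.
Open Scope R_scope.

(* The nonnegative inverse of [cosh] on [1, +oo); see [cosh_arcosh] and
   [arcosh_ge0].  Only the values at u >= 1 are meaningful. *)
Definition arcosh (u : R) : R := ln (u + sqrt (u ^ 2 - 1)).

Lemma arcosh_ge0 (u : R) : 1 <= u -> 0 <= arcosh u.
Proof.
intros Hu; unfold arcosh; rewrite <- ln_1.
pose proof (sqrt_pos (u ^ 2 - 1)) as Hs.
destruct (Req_dec (u + sqrt (u ^ 2 - 1)) 1) as [-> | Hne]; [lra |].
left; apply ln_increasing; lra.
Qed.

Lemma cosh_arcosh (u : R) : 1 <= u -> cosh (arcosh u) = u.
Proof.
intros Hu; unfold cosh, arcosh.
pose proof (sqrt_pos (u ^ 2 - 1)) as Hs.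
assert (Hq : sqrt (u ^ 2 - 1) * sqrt (u ^ 2 - 1) = u ^ 2 - 1)
  by (apply sqrt_sqrt; nra).
rewrite exp_Ropp, exp_ln by lra.
set (s := sqrt (u ^ 2 - 1)) in *.
replace (/ (u + s)) with (u - s); [lra |].
apply (Rmult_eq_reg_l (u + s)); [| lra].
rewrite Rinv_r by lra; nra.
Qed.

(* The hyperbolic plane, as the upper half-plane with the Riemannian metric
   (dx^2 + dy^2) / y^2, and with the distance induced by that metric. *)
Record H2 : Type := mkH2 { px : R; py : R; py_pos : 0 < py }.

Definition C1_on_01 (f : R -> R) : Prop :=
  forall t, 0 <= t <= 1 -> ex_derive f t /\ continuous (Derive f) t.

(* The pair (x, y) is a function on all of R, but only its restriction to
   [0, 1] has to stay in the half-plane. *)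
Definition path_between (p q : H2) (x y : R -> R) : Prop :=
  (C1_on_01 x /\ C1_on_01 y) /\
  (forall t, 0 <= t <= 1 -> 0 < y t) /\
  (x 0 = px p /\ y 0 = py p) /\
  (x 1 = px q /\ y 1 = py q).

Definition path_length (x y : R -> R) : R :=
  RInt (fun t => sqrt (Derive x t ^ 2 + Derive y t ^ 2) / y t) 0 1.

Definition path_lengths (p q : H2) (l : R) : Prop :=
  exists x y : R -> R, path_between p q x y /\ l = path_length x y.

(* [real] maps infinite values to 0, but the infimum is finite: see
   [hdist_glb]. *)
Definition hdist (p q : H2) : R := real (Glb_Rbar (path_lengths p q)).

Lemma ex_RInt_path_length (p q : H2) (x y : R -> R) :
  path_between p q x y ->
  ex_RInt (fun t => sqrt (Derive x t ^ 2 + Derive y t ^ 2) / y t) 0 1.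
Proof.
intros [[Hx Hy] [Hpos _]].
apply (ex_RInt_continuous (V := R_CompleteNormedModule)).
rewrite Rmin_left, Rmax_right by lra; intros t Ht.
destruct (Hx t Ht) as [_ Hx'], (Hy t Ht) as [Hyd Hy'].
specialize (Hpos t Ht).
unfold Rdiv; apply (continuous_mult (K := R_AbsRing)).
- apply continuous_comp.
  + apply (continuous_plus (V := R_NormedModule)); simpl;
      repeat apply (continuous_mult (K := R_AbsRing));
      first [assumption | apply continuous_const].
  + apply continuity_pt_filterlim, continuity_pt_sqrt.
    pose proof (pow2_ge_0 (Derive x t)); pose proof (pow2_ge_0 (Derive y t)).
    simpl in *; unfold plus; simpl; lra.
- apply continuous_comp.
  + now apply (ex_derive_continuous (V := R_NormedModule)).
  + apply continuous_Rinv; lra.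
Qed.

Lemma path_lengths_ge0 (p q : H2) (l : R) : path_lengths p q l -> 0 <= l.
Proof.
intros [x [y [H ->]]]; unfold path_length.
apply RInt_ge_0; [lra | now apply (ex_RInt_path_length p q) |].
intros t Ht; destruct H as [_ [Hpos _]].
apply Rmult_le_pos; [apply sqrt_pos |].
apply Rlt_le, Rinv_0_lt_compat, Hpos; lra.
Qed.

Lemma C1_on_01_affine (a b : R) : C1_on_01 (fun t => a + t * b).
Proof.
intros t _; split.
- auto_derive; trivial.
- apply (continuous_ext (fun _ => b)); [| apply continuous_const].
  intros s; symmetry; apply is_derive_unique; auto_derive; trivial; ring.
Qed.

Lemma path_lengths_nonempty (p q : H2) : exists l, path_lengths p q l.
Proof.
set (x := fun t => px p + t * (px q - px p)).
set (y := fun t => py p + t * (py q - py p)).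
exists (path_length x y), x, y; split; [| reflexivity].
pose proof (py_pos p); pose proof (py_pos q).
repeat split; unfold x, y; try apply C1_on_01_affine; auto; try ring.
intros t Ht; nra.
Qed.

Lemma hdist_glb (p q : H2) : is_glb_Rbar (path_lengths p q) (hdist p q).
Proof.
destruct (path_lengths_nonempty p q) as [l0 Hl0].
pose proof (Glb_Rbar_correct (path_lengths p q)) as HG.
replace (Finite (hdist p q)) with (Glb_Rbar (path_lengths p q)); [exact HG |].
unfold hdist; destruct HG as [Hlb Hgreatest].
assert (H0 : Rbar_le 0 (Glb_Rbar (path_lengths p q))).
{ apply Hgreatest; intros l Hl; exact (path_lengths_ge0 p q l Hl). }
specialize (Hlb l0 Hl0).
destruct (Glb_Rbar (path_lengths p q)); simpl in *; tauto.
Qed.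

Section Quadruples.

Context {X : Type} (dist : X -> X -> R).

Definition max3 (u v w : R) : R := Rmax u (Rmax v w).
Definition min3 (u v w : R) : R := Rmin u (Rmin v w).
Definition mid3 (u v w : R) : R := u + v + w - max3 u v w - min3 u v w.

Definition quad_delta (a b c d : X) : R :=
  let s1 := dist a b + dist c d in
  let s2 := dist a c + dist b d in
  let s3 := dist a d + dist b c in
  (max3 s1 s2 s3 - mid3 s1 s2 s3) / 2.

(* The distances of a point to itself are left out of the maximum: they vanish
   in a metric space. *)
Definition quad_diam (a b c d : X) : R :=
  Rmax (max3 (dist a b) (dist a c) (dist a d))
       (max3 (dist b c) (dist b d) (dist c d)).

Definition Gamma (x : R) : Rbar :=
  Lub_Rbar (fun v => exists a b c d : X,
    quad_diam a b c d = x /\ v = quad_delta a b c d).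

End Quadruples.

(* Main.v *)
Require Import Defs.
From Stdlib Require Import Reals Lra.
From Coquelicot Require Import Coquelicot.
Open Scope R_scope.

(** The hyperbolic plane is handled through the hyperboloid: the half-plane
    point (x, y) is sent by [lift] to the vector (1/y, x/y, (x^2 + y^2)/y) of a
    Lorentzian 3-space, on which the form [mink] takes the value 1, and the
    distance satisfies cosh d(p, q) = [mink (lift p) (lift q)].  That this is the
    infimum of the path lengths ([cosh_hdist]) has two halves.  The geodesic
    t |-> cosh t p + sinh t v has the right length.  No path is shorter, because
    z |-> arcsinh (- [mink (lift z) v]), the signed distance to the line through
    p orthogonal to the geodesic, is smooth, 1-Lipschitz, and grows by exactly
    d(p, q) from p to q.

    The upper bound on delta rests on a rhombus inequality
    ([rhombus_inequality]): if m bounds both sums of opposite sides of a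
    quadrilateral whose diagonals have half-lengths P and Q, then
    cosh (m / 2) >= cosh P cosh Q, with equality for the rhombus.  Suppose that
    the two diagonals lie on lines crossing at O.  The sum of two opposite sides
    is a convex function of the positions of the diagonals on their lines, since
    the distance is jointly convex along geodesics, and the half-turn about O
    makes it even; so it is least when both diagonals are centred at O.  There
    the quadrilateral is a parallelogram, and the average of the cosh of its two
    side lengths is exactly cosh P cosh Q.  Lines that do not cross behave alike,
    with the reflection in their common perpendicular.  The proof below treats
    all cases at once: convexity is that of
    (x1, x2) |-> arcosh (w1 cosh x1 + w2 cosh x2), which is a Cauchy-Schwarz
    inequality ([cosh_mean_ge]), and the weights w1, w2 come from an invariant of
    the pair of lines ([opposite_sides_ge]).

    It follows that delta is at most P + Q - arcosh (cosh P cosh Q), where 2 P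
    and 2 Q are the two distances in the largest sum.  This expression increases
    with P and with Q, both at most x / 2, and P = Q = x / 2 gives the claimed
    value.  A square with diagonals x attains it.  Finally, with
    C = cosh (x / 2), the derivative of the closed form is
    1 - C / sqrt (C^2 + 1), which is nonnegative and decreases. *)

(** * Hyperbolic functions *)

Lemma cosh_plus (x y : R) : cosh (x + y) = cosh x * cosh y + sinh x * sinh y.
Proof.
unfold cosh, sinh; rewrite Ropp_plus_distr, !exp_plus; field.
Qed.

Lemma sinh_plus (x y : R) : sinh (x + y) = sinh x * cosh y + cosh x * sinh y.
Proof.
unfold cosh, sinh; rewrite Ropp_plus_distr, !exp_plus; field.
Qed.

Lemma cosh_opp (x : R) : cosh (- x) = cosh x.
Proof. unfold cosh; rewrite Ropp_involutive; field. Qed.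

Lemma sinh_opp (x : R) : sinh (- x) = - sinh x.
Proof. unfold sinh; rewrite Ropp_involutive; field. Qed.

Lemma cosh_sinh_sqr (x : R) : cosh x ^ 2 - sinh x ^ 2 = 1.
Proof.
pose proof (cosh_plus x (- x)) as H.
rewrite Rplus_opp_r, cosh_0, cosh_opp, sinh_opp in H; lra.
Qed.

Lemma cosh_pos (x : R) : 0 < cosh x.
Proof. unfold cosh; pose proof (exp_pos x); pose proof (exp_pos (- x)); lra. Qed.

Lemma cosh_ge1 (x : R) : 1 <= cosh x.
Proof. pose proof (cosh_sinh_sqr x); pose proof (cosh_pos x); nra. Qed.

Lemma sinh_pos (x : R) : 0 < x -> 0 < sinh x.
Proof.
intros Hx; unfold sinh; pose proof (exp_increasing (- x) x); lra.
Qed.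

Lemma sinh_ge0 (x : R) : 0 <= x -> 0 <= sinh x.
Proof.
intros [Hx | <-]; [now apply Rlt_le, sinh_pos | rewrite sinh_0; lra].
Qed.

Lemma cosh_lt (x y : R) : 0 <= x -> x < y -> cosh x < cosh y.
Proof.
intros Hx Hxy; replace y with (x + (y - x)) by ring; rewrite cosh_plus.
pose proof (sinh_ge0 x Hx); pose proof (sinh_pos (y - x)).
pose proof (cosh_sinh_sqr (y - x)); pose proof (cosh_ge1 (y - x)).
pose proof (cosh_ge1 x).
assert (1 < cosh (y - x)) by nra.
nra.
Qed.

Lemma cosh_le_inv (x y : R) : 0 <= y -> cosh x <= cosh y -> x <= y.
Proof.
intros Hy H; destruct (Rle_lt_dec x y) as [| Hlt]; [assumption |].
pose proof (cosh_lt y x Hy Hlt); lra.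
Qed.

Lemma cosh_le (x y : R) : 0 <= x -> x <= y -> cosh x <= cosh y.
Proof.
intros Hx [Hxy | <-]; [now apply Rlt_le, cosh_lt | apply Rle_refl].
Qed.

Lemma cosh_inj (x y : R) : 0 <= x -> 0 <= y -> cosh x = cosh y -> x = y.
Proof.
intros Hx Hy H; apply Rle_antisym; apply cosh_le_inv; lra.
Qed.

Lemma cosh_double (x : R) : cosh (2 * x) = 2 * cosh x ^ 2 - 1.
Proof.
replace (2 * x) with (x + x) by ring; rewrite cosh_plus.
pose proof (cosh_sinh_sqr x); lra.
Qed.

Lemma cosh_double_sinh (x : R) : cosh (2 * x) = 1 + 2 * sinh x ^ 2.
Proof. rewrite cosh_double; pose proof (cosh_sinh_sqr x); lra. Qed.

Lemma exp_half_sqr (x : R) : exp (x / 2) ^ 2 = cosh x + sinh x.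
Proof.
replace (cosh x + sinh x) with (exp x) by (unfold cosh, sinh; field).
simpl; rewrite Rmult_1_r, <- exp_plus; f_equal; field.
Qed.

Lemma le_of_sqr_le (x y : R) : 0 <= y -> x ^ 2 <= y ^ 2 -> - y <= x <= y.
Proof. intros; split; nra. Qed.

(** * Convexity of the arcosh of an average of cosh *)

Lemma cauchy_schwarz3_sqrt (u v x y x' y' z : R) :
  0 <= u -> 0 <= v -> 0 <= z ->
  u ^ 2 = x ^ 2 + y ^ 2 + z -> v ^ 2 = x' ^ 2 + y' ^ 2 + z ->
  x * x' + y * y' + z <= u * v.
Proof.
intros Hu Hv Hz Eu Ev.
apply Rsqr_incr_0_var; [| now apply Rmult_le_pos].
apply Rminus_le_0; unfold Rsqr.
replace (u * v * (u * v)) with (u ^ 2 * v ^ 2) by ring; rewrite Eu, Ev.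
replace (_ - _)
  with ((x * y' - x' * y) ^ 2 + (z * (x - x') ^ 2 + z * (y - y') ^ 2)) by ring.
apply Rplus_le_le_0_compat; [apply pow2_ge_0 |].
apply Rplus_le_le_0_compat; (apply Rmult_le_pos; [exact Hz | apply pow2_ge_0]).
Qed.

(** Midpoint convexity of g (x1, x2) = arcosh (w1 cosh x1 + w2 cosh x2) for
    weights whose sum is at least 1.  Read ei = exp (Ei / 2), wi = ri si / 2 and
    ri / si = exp Fi: then d = g (E1 - F1, E2 - F2), d' = g (E1 + F1, E2 + F2), and
    the conclusion is cosh ((d + d') / 2) >= w1 cosh E1 + w2 cosh E2.  The factors
    ri and si are kept apart so that one of them may vanish, which happens when
    the two lines of the application share an ideal endpoint.

    The reason is that sinh^2 d is a sum of squares x^2 + y^2 + z, with z common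
    to d and d'; Cauchy-Schwarz bounds sinh d sinh d' from below, and hence
    cosh (d + d') = cosh d cosh d' + sinh d sinh d'. *)
Lemma cosh_mean_ge (d d' e1 i1 e2 i2 r1 s1 r2 s2 : R) :
  0 <= d -> 0 <= d' -> e1 * i1 = 1 -> e2 * i2 = 1 ->
  0 <= r1 * s1 -> 0 <= r2 * s2 -> 2 <= r1 * s1 + r2 * s2 ->
  4 * cosh d = (e1 * s1) ^ 2 + (i1 * r1) ^ 2 + ((e2 * s2) ^ 2 + (i2 * r2) ^ 2) ->
  4 * cosh d' = (e1 * r1) ^ 2 + (i1 * s1) ^ 2 + ((e2 * r2) ^ 2 + (i2 * s2) ^ 2) ->
  (e1 ^ 2 + i1 ^ 2) * (r1 * s1) + (e2 ^ 2 + i2 ^ 2) * (r2 * s2)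
    <= 4 * cosh ((d + d') / 2).
Proof.
intros Hd Hd' He1 He2 H1 H2 Hs E E'.
set (t := (e1 ^ 2 + i1 ^ 2) * (r1 * s1) + (e2 ^ 2 + i2 ^ 2) * (r2 * s2)).
(* x is w1 sinh (E1 - F1) + w2 sinh (E2 - F2), and y is
   2 sqrt (w1 w2) sinh of half the difference of its two arguments. *)
pose (x := ((e1 * s1) ^ 2 - (i1 * r1) ^ 2 + ((e2 * s2) ^ 2 - (i2 * r2) ^ 2)) / 4).
pose (x' := ((e1 * r1) ^ 2 - (i1 * s1) ^ 2 + ((e2 * r2) ^ 2 - (i2 * s2) ^ 2)) / 4).
pose (y := (e1 * s1 * (i2 * r2) - e2 * s2 * (i1 * r1)) / 2).
pose (y' := (e1 * r1 * (i2 * s2) - e2 * r2 * (i1 * s1)) / 2).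
pose (z := ((r1 * s1 + r2 * s2) / 2) ^ 2 - 1).
assert (Hz : 0 <= z) by (unfold z; nra).
assert (Hsum : (r1 * s1 + r2 * s2)
  = (e1 * i1) * (r1 * s1) + (e2 * i2) * (r2 * s2)) by (rewrite He1, He2; ring).
assert (Ex : sinh d ^ 2 = x ^ 2 + y ^ 2 + z).
{ replace (sinh d ^ 2) with (cosh d ^ 2 - 1)
    by (pose proof (cosh_sinh_sqr d); lra).
  replace (cosh d) with (4 * cosh d / 4) by field.
  unfold z; rewrite E, Hsum; unfold x, y; field. }
assert (Ex' : sinh d' ^ 2 = x' ^ 2 + y' ^ 2 + z).
{ replace (sinh d' ^ 2) with (cosh d' ^ 2 - 1)
    by (pose proof (cosh_sinh_sqr d'); lra).
  replace (cosh d') with (4 * cosh d' / 4) by field.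
  unfold z; rewrite E', Hsum; unfold x', y'; field. }
pose proof (cauchy_schwarz3_sqrt _ _ _ _ _ _ _
  (sinh_ge0 d Hd) (sinh_ge0 d' Hd') Hz Ex Ex') as HCS.
pose proof (cosh_double ((d + d') / 2)) as Hdbl.
replace (2 * ((d + d') / 2)) with (d + d') in Hdbl by field.
rewrite cosh_plus in Hdbl.
(* The excess is a nonnegative multiple of
   (cosh (E1 + E2) - 1) (cosh (F1 - F2) - 1). *)
assert (Hid : cosh d * cosh d' + (x * x' + y * y' + z) - (2 * (t / 4) ^ 2 - 1)
  = (e1 * e2 - i1 * i2) ^ 2 * (r1 * s2 - r2 * s1) ^ 2 / 8).
{ replace (cosh d) with (4 * cosh d / 4) by field.
  replace (cosh d') with (4 * cosh d' / 4) by field.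
  rewrite E, E'; unfold z, t, x, y, x', y'.
  assert (e1 <> 0) by (intros ->; lra).
  assert (e2 <> 0) by (intros ->; lra).
  replace i1 with (/ e1) by (apply (Rmult_eq_reg_l e1); [rewrite He1; now field | assumption]).
  replace i2 with (/ e2) by (apply (Rmult_eq_reg_l e2); [rewrite He2; now field | assumption]).
  now field. }
assert (0 <= (e1 * e2 - i1 * i2) ^ 2 * (r1 * s2 - r2 * s1) ^ 2)
  by (apply Rmult_le_pos; apply pow2_ge_0).
pose proof (cosh_pos ((d + d') / 2)).
nra.
Qed.

(** * Lorentzian 3-space and its geodesics *)

Record vec : Type := mkvec { vec0 : R; vec1 : R; vec2 : R }.

(** The quadratic form u0 u2 - u1^2 of signature (1, 2): coordinates 0 and 2 are
    along lightlike directions. *)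
Definition mink (u v : vec) : R := (vec0 u * vec2 v + vec2 u * vec0 v) / 2 - vec1 u * vec1 v.

Definition comb (a : R) (u : vec) (b : R) (v : vec) : vec :=
  mkvec (a * vec0 u + b * vec0 v) (a * vec1 u + b * vec1 v) (a * vec2 u + b * vec2 v).

Lemma mink_combl (a b : R) (u v w : vec) :
  mink (comb a u b v) w = a * mink u w + b * mink v w.
Proof. unfold mink, comb; simpl; field. Qed.

Lemma mink_combr (a b : R) (u v w : vec) :
  mink w (comb a u b v) = a * mink w u + b * mink w v.
Proof. unfold mink, comb; simpl; field. Qed.

Lemma mink_sym (u v : vec) : mink u v = mink v u.
Proof. unfold mink; field. Qed.

(** A point [n] of the hyperboloid with a unit tangent vector [v] there, that is,
    a geodesic with an origin and an orientation. *)
Definition orthoframe (n v : vec) : Prop :=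
  mink n n = 1 /\ mink v v = -1 /\ mink n v = 0.

Definition geod (n v : vec) (t : R) : vec := comb (cosh t) n (sinh t) v.

Lemma mink_geod (n1 v1 n2 v2 : vec) (s t : R) :
  mink (geod n1 v1 s) (geod n2 v2 t)
  = mink n1 n2 * (cosh s * cosh t) + mink v1 v2 * (sinh s * sinh t)
    + mink v1 n2 * (sinh s * cosh t) + mink n1 v2 * (cosh s * sinh t).
Proof. unfold geod; rewrite mink_combl, !mink_combr; ring. Qed.

(** A geodesic never leaves its sheet of the hyperboloid: orthogonality forces
    |v0| <= n0, because n0^2 - v0^2 is the square of n0 v1 - n1 v0. *)
Lemma geod_vec0_pos (n v : vec) (t : R) :
  orthoframe n v -> 0 < vec0 n -> 0 < vec0 (geod n v t).
Proof.
intros [Hn [Hv H]] Hpos; unfold mink in *; simpl.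
assert (Hle : vec0 v ^ 2 <= vec0 n ^ 2).
{ apply Rminus_le_0.
  replace (vec0 n ^ 2 - vec0 v ^ 2) with ((vec0 n * vec1 v - vec1 n * vec0 v) ^ 2);
    [apply pow2_ge_0 |].
  assert (Kn : vec0 n * vec2 n - vec1 n ^ 2 - 1 = 0) by lra.
  assert (Kv : vec0 v * vec2 v - vec1 v ^ 2 + 1 = 0) by lra.
  assert (K : vec0 n * vec2 v + vec2 n * vec0 v - 2 * (vec1 n * vec1 v) = 0) by lra.
  symmetry; apply Rminus_diag_uniq.
  transitivity (vec0 v ^ 2 * (vec0 n * vec2 n - vec1 n ^ 2 - 1)
    - vec0 n * vec0 v * (vec0 n * vec2 v + vec2 n * vec0 v - 2 * (vec1 n * vec1 v))
    + vec0 n ^ 2 * (vec0 v * vec2 v - vec1 v ^ 2 + 1)); [ring |].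
  rewrite Kn, Kv, K; ring. }
destruct (le_of_sqr_le _ _ (Rlt_le _ _ Hpos) Hle).
pose proof (cosh_sinh_sqr t); pose proof (cosh_pos t).
destruct (le_of_sqr_le (sinh t) (cosh t)); [lra | lra |].
assert (sinh t < cosh t) by nra.
assert (- cosh t < sinh t) by nra.
(* Twice the goal is a sum of two nonnegative products, one of them positive. *)
destruct (Rle_lt_dec 0 (vec0 v)).
- assert (0 < (cosh t + sinh t) * (vec0 n + vec0 v)) by (apply Rmult_lt_0_compat; lra).
  assert (0 <= (cosh t - sinh t) * (vec0 n - vec0 v)) by (apply Rmult_le_pos; lra).
  lra.
- assert (0 <= (cosh t + sinh t) * (vec0 n + vec0 v)) by (apply Rmult_le_pos; lra).
  assert (0 < (cosh t - sinh t) * (vec0 n - vec0 v)) by (apply Rmult_lt_0_compat; lra).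
  lra.
Qed.

(** With n0 n2 = 1 + n1^2 and m0 m2 = 1 + m1^2, twice n0 m0 times the form is
    (n0 m1 - m0 n1)^2 + n0^2 + m0^2. *)
Lemma mink_future_pos (n m : vec) :
  mink n n = 1 -> mink m m = 1 -> 0 < vec0 n -> 0 < vec0 m -> 0 < mink n m.
Proof.
unfold mink; intros Hn Hm Pn Pm.
assert (Pnm : 0 < vec0 n * vec0 m) by now apply Rmult_lt_0_compat.
apply (Rmult_lt_reg_l (2 * (vec0 n * vec0 m))); [lra |]; rewrite Rmult_0_r.
replace (_ * _) with
  (vec0 n ^ 2 * (vec0 m * vec2 m) + vec0 m ^ 2 * (vec0 n * vec2 n)
   - 2 * (vec0 n * vec1 n) * (vec0 m * vec1 m)) by field.
replace (vec0 m * vec2 m) with (1 + vec1 m ^ 2) by lra.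
replace (vec0 n * vec2 n) with (1 + vec1 n ^ 2) by lra.
pose proof (pow2_ge_0 (vec0 n * vec1 m - vec0 m * vec1 n)).
pose proof (pow_lt _ 2 Pn); pose proof (pow2_ge_0 (vec0 m)).
lra.
Qed.

(** * The distance of the half-plane on the hyperboloid *)

Definition lift (p : H2) : vec := mkvec (/ py p) (px p / py p) ((px p ^ 2 + py p ^ 2) / py p).

Lemma mink_lift (p q : H2) :
  mink (lift p) (lift q) = 1 + ((px p - px q) ^ 2 + (py p - py q) ^ 2) / (2 * py p * py q).
Proof.
pose proof (py_pos p); pose proof (py_pos q).
unfold mink, lift; simpl; field; lra.
Qed.

Lemma mink_lift_self (p : H2) : mink (lift p) (lift p) = 1.
Proof. pose proof (py_pos p); rewrite mink_lift; field; lra. Qed.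

Lemma mink_lift_ge1 (p q : H2) : 1 <= mink (lift p) (lift q).
Proof.
rewrite mink_lift; apply Rminus_le_0.
pose proof (py_pos p); pose proof (py_pos q).
pose proof (pow2_ge_0 (px p - px q)); pose proof (pow2_ge_0 (py p - py q)).
replace (_ - _) with (((px p - px q) ^ 2 + (py p - py q) ^ 2) / (2 * py p * py q)) by ring.
apply Rdiv_le_0_compat; [lra | nra].
Qed.

Lemma lift_inj (p q : H2) : mink (lift p) (lift q) = 1 -> px p = px q /\ py p = py q.
Proof.
rewrite mink_lift; pose proof (py_pos p); pose proof (py_pos q); intros E.
assert (E' : (px p - px q) ^ 2 + (py p - py q) ^ 2 = 0).
{ assert (0 < 2 * py p * py q) by nra.
  apply (Rmult_eq_reg_r (/ (2 * py p * py q))).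
  - unfold Rdiv in E; lra.
  - apply Rinv_neq_0_compat; lra. }
pose proof (pow2_ge_0 (px p - px q)); pose proof (pow2_ge_0 (py p - py q)).
split; apply Rminus_diag_uniq, Rsqr_0_uniq; unfold Rsqr; lra.
Qed.

(** In the metric of the half-plane, the gradient of f has squared norm
    y^2 (f_x^2 + f_y^2) = f^2 + 1 under the normalisation of the coefficients, so
    arcsinh f is 1-Lipschitz.  The left-hand side is the derivative of f along the
    velocity (x', y'). *)
Lemma gradient_bound (al be ga x y x' y' : R) :
  0 < y -> be ^ 2 - 4 * al * ga = 1 ->
  let f := (al + be * x + ga * (x ^ 2 + y ^ 2)) / y in
  (be * x' + ga * (2 * x * x' + 2 * y * y')) / y - f * y' / y
  <= sqrt (f ^ 2 + 1) * (sqrt (x' ^ 2 + y' ^ 2) / y).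
Proof.
intros Hy Hn f.
set (g := be + 2 * ga * x); set (h := 2 * ga * y - f).
replace (_ - _) with ((g * x' + h * y') / y) by (unfold g, h; field; lra).
unfold Rdiv; rewrite <- Rmult_assoc; apply Rmult_le_compat_r;
  [now apply Rlt_le, Rinv_0_lt_compat |].
replace (f ^ 2 + 1) with (g ^ 2 + h ^ 2)
  by (rewrite <- Hn; unfold g, h, f; field; lra).
pose proof (pow2_ge_0 g); pose proof (pow2_ge_0 h).
pose proof (pow2_ge_0 x'); pose proof (pow2_ge_0 y').
rewrite <- sqrt_mult by lra.
apply Rle_trans with (1 := Rle_abs _); rewrite <- sqrt_Rsqr_abs.
apply sqrt_le_1_alt; unfold Rsqr.
pose proof (pow2_ge_0 (g * y' - h * x')); lra.
Qed.

(** The functions f are the z |-> - [mink (lift z) v] for unit spacelike v, and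
    arcsinh f is the signed distance to the geodesic f = 0.  Unlike the distance to a
    point, it has no singularity along the path. *)
Lemma arcsinh_increment_le_length (al be ga : R) (p q : H2) (x y : R -> R) :
  be ^ 2 - 4 * al * ga = 1 -> path_between p q x y ->
  let f u v := (al + be * u + ga * (u ^ 2 + v ^ 2)) / v in
  arcsinh (f (px q) (py q)) - arcsinh (f (px p) (py p)) <= path_length x y.
Proof.
intros Hn Hp f.
pose proof (ex_RInt_path_length p q x y Hp) as Hex.
destruct Hp as [[Hx Hy] [Hpos [[<- <-] [<- <-]]]].
set (ft := fun t => f (x t) (y t)).
set (df := fun t => (be * Derive x t + ga * (2 * x t * Derive x t + 2 * y t * Derive y t)) / y t
   - ft t * Derive y t / y t).
set (dF := fun t => df t / sqrt (ft t ^ 2 + 1)).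
assert (Hsq : forall t, 0 < sqrt (ft t ^ 2 + 1)).
{ intros t; apply sqrt_lt_R0; pose proof (pow2_ge_0 (ft t)); lra. }
assert (Hf : forall t, 0 <= t <= 1 -> is_derive ft t (df t)).
{ intros t Ht; destruct (Hx t Ht) as [Hx1 _], (Hy t Ht) as [Hy1 _].
  specialize (Hpos t Ht); unfold df, ft, f.
  auto_derive; [repeat split; trivial; lra |].
  rewrite !(Derive_ext (fun s => x s) x), !(Derive_ext (fun s => y s) y) by reflexivity.
  field; lra. }
assert (HF : is_RInt dF 0 1 (minus (arcsinh (ft 1)) (arcsinh (ft 0)))).
{ apply (is_RInt_derive (V := R_CompleteNormedModule) (fun t => arcsinh (ft t)));
    rewrite Rmin_left, Rmax_right by lra; intros t Ht.
  - unfold dF.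
    replace (df t / sqrt (ft t ^ 2 + 1)) with (scal (df t) (/ sqrt (ft t ^ 2 + 1)))
      by reflexivity.
    apply (is_derive_comp (K := R_AbsRing) arcsinh ft); [| now apply Hf].
    apply is_derive_Reals, derivable_pt_lim_arcsinh.
  - assert (Cx : continuous x t)
      by (apply (ex_derive_continuous (V := R_NormedModule)), Hx, Ht).
    assert (Cy : continuous y t)
      by (apply (ex_derive_continuous (V := R_NormedModule)), Hy, Ht).
    assert (Cf : continuous ft t)
      by (apply (ex_derive_continuous (V := R_NormedModule)); exists (df t); apply Hf, Ht).
    assert (Ci : continuous (fun s => / y s) t).
    { apply continuous_comp; [exact Cy | apply continuous_Rinv].
      specialize (Hpos t Ht); lra. }
    destruct (Hx t Ht) as [_ Cx'], (Hy t Ht) as [_ Cy'].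
    assert (Cs : continuous (fun s => / sqrt (ft s ^ 2 + 1)) t).
    { apply continuous_comp.
      - apply continuous_comp.
        + apply (continuous_plus (V := R_NormedModule)); [| apply continuous_const].
          simpl; repeat first [assumption | apply continuous_const
            | apply (continuous_mult (K := R_AbsRing))].
        + apply continuity_pt_filterlim, continuity_pt_sqrt.
          pose proof (pow2_ge_0 (ft t)); unfold plus; simpl in *; lra.
      - apply continuous_Rinv; specialize (Hsq t); lra. }
    unfold dF, df, Rdiv; apply (continuous_mult (K := R_AbsRing)); [| exact Cs].
    apply (continuous_minus (V := R_NormedModule)).
    + apply (continuous_mult (K := R_AbsRing)); [| exact Ci].
      apply (continuous_plus (V := R_NormedModule));
        repeat first [assumption | apply continuous_const
              | apply (continuous_mult (K := R_AbsRing))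
              | apply (continuous_plus (V := R_NormedModule))].
    + repeat first [assumption | apply (continuous_mult (K := R_AbsRing))]. }
replace (arcsinh _ - arcsinh _) with (RInt dF 0 1)
  by (rewrite (is_RInt_unique _ _ _ _ HF); reflexivity).
apply RInt_le; [lra | eexists; exact HF | exact Hex |].
intros t Ht; unfold dF.
apply (Rmult_le_reg_l (sqrt (ft t ^ 2 + 1))); [apply Hsq |].
replace (_ * (df t / _)) with (df t) by (field; apply Rgt_not_eq, Hsq).
apply gradient_bound; [apply Hpos; lra | exact Hn].
Qed.

(** Along the geodesic leaving p in direction v, - [mink (lift z) v] equals
    sinh of the arc length. *)
Lemma geodesic_le_path_length (p q : H2) (v : vec) (d l : R) :
  orthoframe (lift p) v -> geod (lift p) v d = lift q -> path_lengths p q l -> d <= l.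
Proof.
intros [Hn [Hv H]] Hq [x [y [Hp ->]]].
pose proof (arcsinh_increment_le_length (- vec2 v / 2) (vec1 v) (- vec0 v / 2) p q x y) as L.
cbv beta zeta in L.
assert (E : forall z : H2, (- vec2 v / 2 + vec1 v * px z
    + - vec0 v / 2 * (px z ^ 2 + py z ^ 2)) / py z
  = - mink (lift z) v).
{ intros z; pose proof (py_pos z); unfold mink, lift; simpl; field; lra. }
rewrite !E, <- Hq in L; unfold geod in L; rewrite mink_combl, H, Hv in L.
replace (- (cosh d * 0 + sinh d * -1)) with (sinh d) in L by ring.
rewrite Ropp_0, arcsinh_0, arcsinh_sinh in L.
assert (vec1 v ^ 2 - 4 * (- vec2 v / 2) * (- vec0 v / 2) = 1) by (unfold mink in Hv; lra).
specialize (L H0 Hp); lra.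
Qed.

Lemma is_derive_geod_coord (a b d t : R) :
  is_derive (fun s => cosh (s * d) * a + sinh (s * d) * b) t
    (d * (sinh (t * d) * a + cosh (t * d) * b)).
Proof.
unfold cosh, sinh; auto_derive; trivial; field.
Qed.

Lemma C1_on_01_of_derive (f f' : R -> R) :
  (forall t, is_derive f t (f' t)) -> (forall t, ex_derive f' t) -> C1_on_01 f.
Proof.
intros Df Xf t _; split; [exists (f' t); apply Df |].
apply (continuous_ext f'); [intros s; symmetry; apply is_derive_unique, Df |].
apply (ex_derive_continuous (V := R_NormedModule)), Xf.
Qed.

(** The half-plane coordinates of the vector u are x = u1 / u0 and y = 1 / u0, and
    the squared speed (x'^2 + y'^2) / y^2 of a curve on the hyperboloid is minus
    the form on its velocity, here d^2. *)
Lemma geodesic_path_length (p q : H2) (v : vec) (d : R) :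
  orthoframe (lift p) v -> 0 <= d -> geod (lift p) v d = lift q -> path_lengths p q d.
Proof.
intros F Hd Hq.
set (g := fun t => geod (lift p) v (t * d)).
set (g' := fun t => comb (d * sinh (t * d)) (lift p) (d * cosh (t * d)) v).
assert (Hpos : forall t, 0 < vec0 (g t)).
{ intros t; apply geod_vec0_pos; [exact F |].
  simpl; apply Rinv_0_lt_compat, py_pos. }
assert (D0 : forall t, is_derive (fun s => vec0 (g s)) t (vec0 (g' t))).
{ intros t; unfold g, g'; simpl.
  replace (d * sinh (t * d) * / py p + d * cosh (t * d) * vec0 v)
    with (d * (sinh (t * d) * / py p + cosh (t * d) * vec0 v)) by ring.
  apply is_derive_geod_coord. }
assert (D1 : forall t, is_derive (fun s => vec1 (g s)) t (vec1 (g' t))).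
{ intros t; unfold g, g'; simpl.
  replace (d * sinh (t * d) * (px p / py p) + d * cosh (t * d) * vec1 v)
    with (d * (sinh (t * d) * (px p / py p) + cosh (t * d) * vec1 v)) by ring.
  apply is_derive_geod_coord. }
assert (X0 : forall t, ex_derive (fun s => vec0 (g s)) t) by (intros t; eexists; apply D0).
assert (X1 : forall t, ex_derive (fun s => vec1 (g s)) t) by (intros t; eexists; apply D1).
assert (X0' : forall t, ex_derive (fun s => vec0 (g' s)) t).
{ intros t; unfold g', comb, cosh, sinh; simpl; auto_derive; trivial. }
assert (X1' : forall t, ex_derive (fun s => vec1 (g' s)) t).
{ intros t; unfold g', comb, cosh, sinh; simpl; auto_derive; trivial. }
set (x := fun t => vec1 (g t) / vec0 (g t)); set (y := fun t => / vec0 (g t)).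
assert (Dx : forall t, is_derive x t
  ((vec1 (g' t) * vec0 (g t) - vec1 (g t) * vec0 (g' t)) / vec0 (g t) ^ 2)).
{ intros t; apply is_derive_div; [apply D1 | apply D0 | apply Rgt_not_eq, Hpos]. }
assert (Dy : forall t, is_derive y t (- vec0 (g' t) / vec0 (g t) ^ 2)).
{ intros t; apply is_derive_inv; [apply D0 | apply Rgt_not_eq, Hpos]. }
exists x, y; split.
- split; [| split; [| split]].
  + split.
    * apply (C1_on_01_of_derive _ _ Dx); intros t.
      apply ex_derive_div; [| apply (ex_derive_pow (fun s => vec0 (g s))), X0 |].
      -- apply (ex_derive_minus (fun s => vec1 (g' s) * vec0 (g s))
           (fun s => vec1 (g s) * vec0 (g' s)));
           apply ex_derive_mult; auto.
      -- apply pow_nonzero, Rgt_not_eq, Hpos.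
    * apply (C1_on_01_of_derive _ _ Dy); intros t.
      apply ex_derive_div; [| apply (ex_derive_pow (fun s => vec0 (g s))), X0 |].
      -- apply (ex_derive_opp (fun s => vec0 (g' s))); auto.
      -- apply pow_nonzero, Rgt_not_eq, Hpos.
  + intros t _; apply Rinv_0_lt_compat, Hpos.
  + pose proof (py_pos p); unfold x, y, g; rewrite Rmult_0_l; simpl.
    rewrite cosh_0, sinh_0; split; field; lra.
  + pose proof (py_pos q); unfold x, y, g; rewrite Rmult_1_l, Hq; simpl.
    split; field; lra.
- unfold path_length.
  rewrite (RInt_ext _ (fun _ => d));
    [rewrite RInt_const; unfold scal; simpl; unfold mult; simpl; ring |].
  intros t _; rewrite (is_derive_unique _ _ _ (Dx t)), (is_derive_unique _ _ _ (Dy t)).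
  unfold y.
  specialize (Hpos t).
  assert (N : mink (g t) (g t) = 1 /\ mink (g' t) (g' t) = - d ^ 2 /\ mink (g t) (g' t) = 0).
  { unfold g, g', geod; rewrite !mink_combl, !mink_combr, (mink_sym v).
    destruct F as [-> [-> ->]]; pose proof (cosh_sinh_sqr (t * d)).
    repeat split; [lra | | ring].
    replace (- d ^ 2) with (- d ^ 2 * (cosh (t * d) ^ 2 - sinh (t * d) ^ 2))
      by (rewrite H; ring).
    ring. }
  destruct N as [N1 [N2 N3]]; unfold mink in N1, N2, N3.
  revert Hpos N1 N2 N3.
  generalize (vec0 (g t)) (vec1 (g t)) (vec2 (g t)) (vec0 (g' t)) (vec1 (g' t)) (vec2 (g' t)).
  intros a0 a1 a2 b0 b1 b2 Ha N1 N2 N3.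
  replace (_ ^ 2 + _ ^ 2) with ((d / a0) ^ 2).
  + rewrite <- Rsqr_pow2, sqrt_Rsqr; [| apply Rdiv_le_0_compat; lra].
    change (@eq R (d / a0 / / a0) d); field; lra.
  + replace (d ^ 2) with (b1 ^ 2 - b0 * b2) by lra.
    assert (Ea : a2 = (1 + a1 ^ 2) / a0) by (apply (Rmult_eq_reg_l a0); [field_simplify; lra | lra]).
    assert (Eb : b2 = (2 * a1 * b1 - a2 * b0) / a0)
      by (apply (Rmult_eq_reg_l a0); [field_simplify; lra | lra]).
    replace ((d / a0) ^ 2) with ((b1 ^ 2 - b0 * b2) / a0 ^ 2)
      by (replace (b1 ^ 2 - b0 * b2) with (d ^ 2) by lra; field; lra).
    rewrite Eb, Ea; field; lra.
Qed.

(** For p <> q, the direction is the normalised component of q orthogonal to p.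
    When p = q any unit tangent vector does, and (0, 1, 2x) is y d/dx. *)
Lemma geodesic_direction (p q : H2) :
  exists (v : vec) (d : R), orthoframe (lift p) v /\ 0 <= d /\ geod (lift p) v d = lift q.
Proof.
set (k := mink (lift p) (lift q)).
pose proof (mink_lift_self p) as Hp; pose proof (mink_lift_self q) as Hq.
destruct (mink_lift_ge1 p q) as [Hlt | Heq].
- fold k in Hlt; set (d := arcosh k).
  assert (Hk : cosh d = k) by (apply cosh_arcosh; lra).
  assert (Hd : 0 <= d) by (apply arcosh_ge0; lra).
  assert (Hs : 0 < sinh d).
  { destruct Hd as [Hd | Hd]; [now apply sinh_pos |].
    rewrite <- Hd, cosh_0 in Hk; lra. }
  pose proof (cosh_sinh_sqr d) as Hcs.
  exists (comb (- cosh d / sinh d) (lift p) (/ sinh d) (lift q)), d.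
  split; [split; [exact Hp | split] | split; [exact Hd |]].
  + rewrite mink_combl, !mink_combr, (mink_sym (lift q)), Hp, Hq; fold k; rewrite <- Hk.
    apply (Rmult_eq_reg_r (sinh d ^ 2)); [field_simplify; lra | apply Rgt_not_eq; nra].
  + rewrite mink_combr, Hp; fold k; rewrite <- Hk; field; lra.
  + unfold geod, comb, lift; simpl; f_equal; field; repeat split;
      first [lra | apply Rgt_not_eq, py_pos].
- exists (mkvec 0 1 (2 * px p)), 0.
  symmetry in Heq; destruct (lift_inj p q Heq) as [E1 E2].
  pose proof (py_pos p).
  split; [split; [exact Hp | split] | split; [lra |]].
  + unfold mink; simpl; field.
  + unfold mink; simpl; field; lra.
  + unfold geod, comb, lift; rewrite cosh_0, sinh_0, <- E1, <- E2; simpl; f_equal; ring.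
Qed.

Lemma hdist_geod (p q : H2) (v : vec) (d : R) :
  orthoframe (lift p) v -> 0 <= d -> geod (lift p) v d = lift q -> hdist p q = d.
Proof.
intros F Hd Hq; unfold hdist.
rewrite (is_glb_Rbar_unique _ (Finite d)); [reflexivity |].
split.
- intros l Hl; exact (geodesic_le_path_length p q v d l F Hq Hl).
- intros b Hb; apply Hb; now apply (geodesic_path_length p q v).
Qed.

Lemma cosh_hdist (p q : H2) : cosh (hdist p q) = mink (lift p) (lift q).
Proof.
destruct (geodesic_direction p q) as [v [d [F [Hd Hq]]]].
rewrite (hdist_geod p q v d F Hd Hq), <- Hq; unfold geod.
destruct F as [Hn [_ H]]; rewrite mink_combr, Hn, H; ring.
Qed.

Lemma hdist_ge0 (p q : H2) : 0 <= hdist p q.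
Proof.
destruct (geodesic_direction p q) as [v [d [F [Hd Hq]]]].
now rewrite (hdist_geod p q v d F Hd Hq).
Qed.

Lemma hdist_sym (p q : H2) : hdist p q = hdist q p.
Proof.
apply cosh_inj; try apply hdist_ge0; rewrite !cosh_hdist; apply mink_sym.
Qed.

(** Centring the frame at the midpoint puts the two endpoints at opposite
    parameters, the form in which diagonals are used below. *)
Lemma midpoint_frame (p q : H2) :
  exists n v : vec, orthoframe n v /\ 0 < vec0 n /\
    geod n v (- (hdist p q / 2)) = lift p /\ geod n v (hdist p q / 2) = lift q.
Proof.
destruct (geodesic_direction p q) as [v [d [F [Hd Hq]]]].
rewrite (hdist_geod p q v d F Hd Hq).
set (h := d / 2).
pose proof (cosh_sinh_sqr h) as Hcs.
exists (geod (lift p) v h), (comb (sinh h) (lift p) (cosh h) v).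
split; [| split; [| split]].
- destruct F as [Hn [Hv H]]; unfold orthoframe, geod.
  rewrite !mink_combl, !mink_combr, (mink_sym v), Hn, Hv, H; repeat split; lra.
- apply geod_vec0_pos; [exact F | apply Rinv_0_lt_compat, py_pos].
- unfold geod, comb; rewrite cosh_opp, sinh_opp.
  transitivity (mkvec ((cosh h ^ 2 - sinh h ^ 2) * vec0 (lift p))
    ((cosh h ^ 2 - sinh h ^ 2) * vec1 (lift p)) ((cosh h ^ 2 - sinh h ^ 2) * vec2 (lift p))).
  + cbn [vec0 vec1 vec2]; f_equal; ring.
  + rewrite Hcs; unfold lift; simpl; f_equal; ring.
- rewrite <- Hq; unfold geod, comb; replace d with (h + h) by (unfold h; field).
  rewrite cosh_plus, sinh_plus; cbn [vec0 vec1 vec2]; f_equal; ring.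
Qed.

(** * Invariants of a pair of lines *)

(** The Gram determinant is the square of the coordinate determinant times the
    determinant of the form, which is positive for signature (1, 2). *)
Lemma gram3_ge0 (u v w : vec) :
  0 <= mink u u * (mink v v * mink w w - mink v w ^ 2)
       - mink u v * (mink u v * mink w w - mink v w * mink u w)
       + mink u w * (mink u v * mink v w - mink v v * mink u w).
Proof.
replace (_ + _) with
  ((vec0 u * (vec1 v * vec2 w - vec2 v * vec1 w) - vec1 u * (vec0 v * vec2 w - vec2 v * vec0 w)
    + vec2 u * (vec0 v * vec1 w - vec1 v * vec0 w)) ^ 2 / 4)
  by (unfold mink; field).
apply Rmult_le_pos; [apply pow2_ge_0 | lra].
Qed.

Definition det3 (a b c d e f g h i : R) : R :=
  a * (e * i - f * h) - b * (d * i - f * g) + c * (d * h - e * g).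

(** Four vectors of a 3-dimensional space are dependent; the left-hand side is
    their Gram determinant. *)
Lemma gram4_eq0 (u v w x : vec) :
  mink u u * det3 (mink v v) (mink v w) (mink v x)
                  (mink v w) (mink w w) (mink w x)
                  (mink v x) (mink w x) (mink x x)
  - mink u v * det3 (mink u v) (mink v w) (mink v x)
                    (mink u w) (mink w w) (mink w x)
                    (mink u x) (mink w x) (mink x x)
  + mink u w * det3 (mink u v) (mink v v) (mink v x)
                    (mink u w) (mink v w) (mink w x)
                    (mink u x) (mink v x) (mink x x)
  - mink u x * det3 (mink u v) (mink v v) (mink v w)
                    (mink u w) (mink v w) (mink w w)
                    (mink u x) (mink v x) (mink w x) = 0.
Proof. unfold det3, mink; destruct u, v, w, x; simpl; field. Qed.

(** With k = n1.n2, m = v1.v2, e = v1.n2, f = n1.v2 and D = k m - e f, this is equivalent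
    to (k + m)^2 - (e + f)^2 = (1 + D)^2 and to (k - m)^2 - (e - f)^2 = (1 - D)^2.
    D does not change when the origins slide along the two geodesics; it is, up to
    sign, the cosine of their angle if they cross and cosh of their distance if they
    are ultraparallel. *)
Lemma orthoframe_relation (n1 v1 n2 v2 : vec) :
  orthoframe n1 v1 -> orthoframe n2 v2 ->
  mink n1 n2 ^ 2 + mink v1 v2 ^ 2 - mink v1 n2 ^ 2 - mink n1 v2 ^ 2
  = 1 + (mink n1 n2 * mink v1 v2 - mink v1 n2 * mink n1 v2) ^ 2.
Proof.
intros [Hn1 [Hv1 H1]] [Hn2 [Hv2 H2]].
pose proof (gram4_eq0 n1 v1 n2 v2) as H; unfold det3 in H.
rewrite Hn1, Hv1, H1, Hn2, Hv2, H2 in H; lra.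
Qed.

(** The four numbers k + m +- (e + f) and k - m +- (e - f) are the products
    of the lightlike vectors n1 +- v1 and n2 +- v2, which point to the ideal
    endpoints of the geodesics and lie in the same half of the light cone. *)
Lemma lightlike_ge0 (n1 v1 n2 v2 : vec) :
  orthoframe n1 v1 -> orthoframe n2 v2 -> 0 < mink n1 n2 ->
  Rabs (mink v1 n2 + mink n1 v2) <= mink n1 n2 + mink v1 v2 /\
  Rabs (mink v1 n2 - mink n1 v2) <= mink n1 n2 - mink v1 v2.
Proof.
intros F1 F2 Hk.
pose proof (orthoframe_relation _ _ _ _ F1 F2) as HR.
destruct F1 as [Hn1 [Hv1 H1]], F2 as [Hn2 [Hv2 H2]].
pose proof (gram3_ge0 n1 n2 v2) as G1; pose proof (gram3_ge0 n1 v1 v2) as G2.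
rewrite Hn1, Hn2, Hv2, H2 in G1; rewrite Hn1, Hv1, Hv2, H1 in G2.
set (k := mink n1 n2) in *; set (m := mink v1 v2) in *.
set (e := mink v1 n2) in *; set (f := mink n1 v2) in *.
assert (Hmk : m ^ 2 <= k ^ 2) by lra.
destruct (le_of_sqr_le m k (Rlt_le _ _ Hk) Hmk) as [Hm1 Hm2].
pose proof (pow2_ge_0 (1 + (k * m - e * f))).
pose proof (pow2_ge_0 (1 - (k * m - e * f))).
split; apply Rabs_le, le_of_sqr_le; lra.
Qed.

(** * The rhombus inequality *)

(** For p = P and q = Q this bounds the sum of one pair of opposite sides by its
    value (or limit, if the lines share an ideal endpoint) when the diagonals are
    moved to the centre of symmetry of their lines.
    Since det is invariant under such moves, the bound only depends on it.  In terms of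
    k, m, e, f the cosh of the first side is the average of
    (k + m) cosh (p + q) - (e + f) sinh (p + q) and
    (k - m) cosh (p - q) - (e - f) sinh (p - q), and the other side has plus signs;
    by [orthoframe_relation] this is the pattern of [cosh_mean_ge], the weights
    being |1 + det| / 2 and |1 - det| / 2. *)
Lemma opposite_sides_ge (n1 v1 n2 v2 : vec) (p q d d' : R) :
  orthoframe n1 v1 -> orthoframe n2 v2 -> 0 < mink n1 n2 ->
  0 <= d -> 0 <= d' ->
  cosh d = mink (geod n1 v1 (- p)) (geod n2 v2 (- q)) ->
  cosh d' = mink (geod n1 v1 p) (geod n2 v2 q) ->
  let det := mink n1 n2 * mink v1 v2 - mink v1 n2 * mink n1 v2 in
  cosh (p + q) * Rabs (1 + det) + cosh (p - q) * Rabs (1 - det)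
    <= 2 * cosh ((d + d') / 2).
Proof.
intros F1 F2 Hk Hd Hd' E E' det.
rewrite mink_geod, ?cosh_opp, ?sinh_opp in E.
rewrite mink_geod in E'.
pose proof (orthoframe_relation _ _ _ _ F1 F2) as HR.
destruct (lightlike_ge0 _ _ _ _ F1 F2 Hk) as [L L'].
apply Rabs_le_between in L; apply Rabs_le_between in L'.
revert HR L L' E E'; unfold det; clear det.
generalize (mink n1 n2) (mink v1 v2) (mink v1 n2) (mink n1 v2).
clear -Hd Hd'; intros k m e f HR L L' E E'.
set (det := k * m - e * f) in *.
set (r1 := sqrt (k + m + (e + f))); set (s1 := sqrt (k + m - (e + f))).
set (r2 := sqrt (k - m + (e - f))); set (s2 := sqrt (k - m - (e - f))).
assert (Er1 : r1 ^ 2 = k + m + (e + f)) by (apply pow2_sqrt; lra).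
assert (Es1 : s1 ^ 2 = k + m - (e + f)) by (apply pow2_sqrt; lra).
assert (Er2 : r2 ^ 2 = k - m + (e - f)) by (apply pow2_sqrt; lra).
assert (Es2 : s2 ^ 2 = k - m - (e - f)) by (apply pow2_sqrt; lra).
assert (H1 : Rabs (1 + det) = r1 * s1).
{ unfold r1, s1; rewrite <- sqrt_mult by lra; rewrite <- sqrt_Rsqr_abs.
  f_equal; unfold Rsqr; revert HR; unfold det; intros; lra. }
assert (H2 : Rabs (1 - det) = r2 * s2).
{ unfold r2, s2; rewrite <- sqrt_mult by lra; rewrite <- sqrt_Rsqr_abs.
  f_equal; unfold Rsqr; revert HR; unfold det; intros; lra. }
pose proof (exp_half_sqr (p + q)) as P1; pose proof (exp_half_sqr (- (p + q))) as I1.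
pose proof (exp_half_sqr (p - q)) as P2; pose proof (exp_half_sqr (- (p - q))) as I2.
rewrite cosh_opp, sinh_opp in I1, I2.
assert (X1 : exp ((p + q) / 2) * exp (- (p + q) / 2) = 1)
  by (rewrite <- exp_plus, <- exp_0; f_equal; field).
assert (X2 : exp ((p - q) / 2) * exp (- (p - q) / 2) = 1)
  by (rewrite <- exp_plus, <- exp_0; f_equal; field).
assert (T : 2 <= r1 * s1 + r2 * s2).
{ rewrite <- H1, <- H2; pose proof (Rle_abs (1 + det)); pose proof (Rle_abs (1 - det)); lra. }
assert (N1 : 0 <= r1 * s1) by (rewrite <- H1; apply Rabs_pos).
assert (N2 : 0 <= r2 * s2) by (rewrite <- H2; apply Rabs_pos).
pose proof (cosh_mean_ge d d' _ _ _ _ r1 s1 r2 s2 Hd Hd' X1 X2 N1 N2 T) as HC.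
rewrite !Rpow_mult_distr, P1, P2, I1, I2, Er1, Er2, Es1, Es2, E, E' in HC.
rewrite H1, H2.
unfold Rminus in HC |- *;
  rewrite ?cosh_plus, ?sinh_plus, ?cosh_opp, ?sinh_opp in HC;
  rewrite !cosh_plus, cosh_opp, sinh_opp.
assert (Y := HC ltac:(ring) ltac:(ring)); lra.
Qed.

(** The other pair of opposite sides is the same statement with q replaced
    by - q, which exchanges cosh (p + q) and cosh (p - q).  In the sum of the two bounds
    the weights factor out, and they add up to at least 1. *)
Lemma diagonals_le (n1 v1 n2 v2 : vec) (p q ab bc cd da m : R) :
  orthoframe n1 v1 -> orthoframe n2 v2 -> 0 < mink n1 n2 ->
  0 <= ab -> 0 <= bc -> 0 <= cd -> 0 <= da ->
  cosh ab = mink (geod n1 v1 (- p)) (geod n2 v2 (- q)) ->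
  cosh bc = mink (geod n1 v1 p) (geod n2 v2 (- q)) ->
  cosh cd = mink (geod n1 v1 p) (geod n2 v2 q) ->
  cosh da = mink (geod n1 v1 (- p)) (geod n2 v2 q) ->
  ab + cd <= m -> bc + da <= m ->
  cosh p * cosh q <= cosh (m / 2).
Proof.
intros F1 F2 Hk Hab Hbc Hcd Hda Eab Ebc Ecd Eda M1 M2.
pose proof (opposite_sides_ge _ _ _ _ p q ab cd F1 F2 Hk Hab Hcd Eab Ecd) as K1.
pose proof (opposite_sides_ge n1 v1 n2 v2 p (- q) da bc F1 F2 Hk Hda Hbc) as K2.
rewrite Ropp_involutive in K2; specialize (K2 Eda Ebc); cbv zeta in K1, K2.
set (det := mink n1 n2 * mink v1 v2 - mink v1 n2 * mink n1 v2) in *.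
replace (p - - q) with (p + q) in K2 by ring.
replace (p + - q) with (p - q) in K2 by ring.
assert (C1 : cosh ((ab + cd) / 2) <= cosh (m / 2)) by (apply cosh_le; lra).
assert (C2 : cosh ((da + bc) / 2) <= cosh (m / 2)) by (apply cosh_le; lra).
assert (H2 : 2 <= Rabs (1 + det) + Rabs (1 - det)).
{ pose proof (Rle_abs (1 + det)); pose proof (Rle_abs (1 - det)); lra. }
assert (HC : cosh (p + q) + cosh (p - q) = 2 * (cosh p * cosh q)).
{ unfold Rminus; rewrite !cosh_plus, cosh_opp, sinh_opp; ring. }
pose proof (cosh_pos (p + q)); pose proof (cosh_pos (p - q)).
nra.
Qed.

Lemma rhombus_inequality (a b c d : H2) (m : R) :
  hdist a b + hdist c d <= m -> hdist a d + hdist b c <= m ->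
  cosh (hdist a c / 2) * cosh (hdist b d / 2) <= cosh (m / 2).
Proof.
intros M1 M2.
destruct (midpoint_frame a c) as [n1 [v1 [F1 [P1 [Ea Ec]]]]].
destruct (midpoint_frame b d) as [n2 [v2 [F2 [P2 [Eb Ed]]]]].
apply (diagonals_le n1 v1 n2 v2 _ _ (hdist a b) (hdist b c) (hdist c d) (hdist a d));
  rewrite ?Ea, ?Eb, ?Ec, ?Ed, ?cosh_hdist; auto using hdist_ge0, mink_sym; [| lra].
apply mink_future_pos; [apply F1 | apply F2 | assumption | assumption].
Qed.

(** * The upper bound *)

(** Adding t to p multiplies cosh p cosh q by no more than adding t to
    s = arcosh (cosh p cosh q) multiplies cosh s, because sinh s >= sinh p cosh q.
    Hence p + q - arcosh (cosh p cosh q) increases with p. *)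
Lemma arcosh_mul_cosh_increment_le (p p' q : R) : 0 <= p <= p' ->
  arcosh (cosh p' * cosh q) <= arcosh (cosh p * cosh q) + (p' - p).
Proof.
intros Hp.
assert (H : forall u, 1 <= cosh u * cosh q).
{ intros u; pose proof (cosh_ge1 u); pose proof (cosh_ge1 q); nra. }
set (s := arcosh (cosh p * cosh q)).
assert (Hs : 0 <= s) by apply arcosh_ge0, H.
assert (Cs : cosh s = cosh p * cosh q) by apply cosh_arcosh, H.
apply cosh_le_inv; [lra |].
rewrite cosh_arcosh, cosh_plus, Cs by apply H.
replace p' with (p + (p' - p)) at 1 by ring; rewrite cosh_plus.
assert (Hsinh : sinh p * cosh q <= sinh s).
{ apply Rsqr_incr_0_var; [| now apply sinh_ge0].
  unfold Rsqr; pose proof (cosh_sinh_sqr s) as Es; rewrite Cs in Es.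
  pose proof (cosh_sinh_sqr p) as Ep; pose proof (cosh_ge1 q).
  replace (sinh p * cosh q * (sinh p * cosh q)) with ((cosh p ^ 2 - 1) * cosh q ^ 2)
    by (rewrite <- Ep; ring).
  nra. }
pose proof (sinh_ge0 (p' - p)); nra.
Qed.

Definition gamma (x : R) : R := x - arcosh (cosh (x / 2) ^ 2).

Lemma diagonals_defect_le (a b c d : H2) (x : R) :
  hdist a c <= x -> hdist b d <= x ->
  hdist a c + hdist b d - Rmax (hdist a b + hdist c d) (hdist a d + hdist b c)
    <= 2 * gamma x.
Proof.
intros Hp Hq.
pose proof (hdist_ge0 a c) as Hp0; pose proof (hdist_ge0 b d) as Hq0.
set (m := Rmax _ _).
pose proof (rhombus_inequality a b c d m (Rmax_l _ _) (Rmax_r _ _)) as HR.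
assert (Hm : 0 <= m).
{ apply Rle_trans with (2 := Rmax_l _ _).
  pose proof (hdist_ge0 a b); pose proof (hdist_ge0 c d); lra. }
set (p := hdist a c / 2) in *; set (q := hdist b d / 2) in *.
assert (Hm2 : arcosh (cosh p * cosh q) <= m / 2).
{ apply cosh_le_inv; [lra |]; rewrite cosh_arcosh; [exact HR |].
  pose proof (cosh_ge1 p); pose proof (cosh_ge1 q); nra. }
pose proof (arcosh_mul_cosh_increment_le p (x / 2) q ltac:(unfold p; lra)) as L1.
pose proof (arcosh_mul_cosh_increment_le q (x / 2) (x / 2) ltac:(unfold q; lra)) as L2.
rewrite (Rmult_comm (cosh q)) in L2.
unfold gamma; replace (cosh (x / 2) ^ 2) with (cosh (x / 2) * cosh (x / 2)) by ring.
unfold p, q in *; lra.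
Qed.

Lemma max3_ge (u v w : R) : u <= max3 u v w /\ v <= max3 u v w /\ w <= max3 u v w.
Proof.
unfold max3; pose proof (Rmax_l u (Rmax v w)); pose proof (Rmax_r u (Rmax v w)).
pose proof (Rmax_l v w); pose proof (Rmax_r v w); lra.
Qed.

(** The middle value is the maximum of the two others once the largest is
    known, so one hypothesis is needed for each candidate. *)
Lemma max3_sub_mid3_le (u v w e : R) :
  u - Rmax v w <= e -> v - Rmax u w <= e -> w - Rmax u v <= e ->
  max3 u v w - mid3 u v w <= e.
Proof.
unfold mid3, max3, min3, Rmax, Rmin.
repeat destruct (Rle_dec _ _); lra.
Qed.

Lemma quad_delta_le (a b c d : H2) :
  quad_delta hdist a b c d <= gamma (quad_diam hdist a b c d).
Proof.
set (x := quad_diam hdist a b c d).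
pose proof (max3_ge (hdist a b) (hdist a c) (hdist a d)) as D1.
pose proof (max3_ge (hdist b c) (hdist b d) (hdist c d)) as D2.
pose proof (Rmax_l (max3 (hdist a b) (hdist a c) (hdist a d))
                   (max3 (hdist b c) (hdist b d) (hdist c d))) as D3.
pose proof (Rmax_r (max3 (hdist a b) (hdist a c) (hdist a d))
                   (max3 (hdist b c) (hdist b d) (hdist c d))) as D4.
fold (quad_diam hdist a b c d) in D3, D4; fold x in D3, D4.
unfold quad_delta; cbv zeta.
enough (E : max3 (hdist a b + hdist c d) (hdist a c + hdist b d) (hdist a d + hdist b c)
  - mid3 (hdist a b + hdist c d) (hdist a c + hdist b d) (hdist a d + hdist b c)
  <= 2 * gamma x) by lra.
pose proof (diagonals_defect_le a c b d x) as K1; rewrite (hdist_sym c b) in K1.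
pose proof (diagonals_defect_le a b c d x) as K2.
pose proof (diagonals_defect_le a b d c x) as K3; rewrite (hdist_sym d c) in K3.
apply max3_sub_mid3_le; lra.
Qed.

(** * The square attains the bound *)

Lemma gamma_ge0 (x : R) : 0 <= x -> 0 <= gamma x.
Proof.
intros Hx; unfold gamma.
enough (arcosh (cosh (x / 2) ^ 2) <= x) by lra.
pose proof (cosh_ge1 (x / 2)).
apply cosh_le_inv; [exact Hx |]; rewrite cosh_arcosh by nra.
replace x with (2 * (x / 2)) at 2 by field; rewrite cosh_double; nra.
Qed.

Lemma inv_cosh_pos (t : R) : 0 < / cosh t.
Proof. apply Rinv_0_lt_compat, cosh_pos. Qed.

(** The vertices of a square centred at (0, 1): [square_top t] and
    [square_top (- t)] on the vertical geodesic, [square_side t] and [square_side (- t)] on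
    the unit circle, all at distance |t| from the centre. *)
Definition square_top (t : R) : H2 := mkH2 0 (exp t) (exp_pos t).

Definition square_side (t : R) : H2 := mkH2 (sinh t / cosh t) (/ cosh t) (inv_cosh_pos t).

Lemma hdist_square_diagonals (t : R) : 0 <= t ->
  hdist (square_top t) (square_top (- t)) = 2 * t /\
  hdist (square_side t) (square_side (- t)) = 2 * t.
Proof.
intros Ht; pose proof (cosh_pos t); pose proof (exp_pos t).
split; apply cosh_inj; try apply hdist_ge0; try lra; rewrite cosh_hdist, mink_lift; simpl.
- rewrite exp_Ropp; unfold cosh.
  replace (- (2 * t)) with (- t + - t) by ring; replace (2 * t) with (t + t) by ring.
  rewrite !exp_plus, exp_Ropp; field; lra.
- rewrite cosh_opp, sinh_opp, cosh_double_sinh; field; lra.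
Qed.

(** This is the hyperbolic Pythagorean theorem for the right triangle
    with legs t whose right angle is at the centre. *)
Lemma hdist_square_sides (t s u : R) : 0 <= t -> Rabs s = t -> Rabs u = t ->
  hdist (square_top s) (square_side u) = arcosh (cosh t ^ 2).
Proof.
intros Ht Hs Hu; pose proof (cosh_ge1 t).
assert (Hcs : forall w, Rabs w = t -> cosh w = cosh t).
{ intros w <-; unfold Rabs; destruct (Rcase_abs w); [now rewrite cosh_opp | reflexivity]. }
apply cosh_inj; [apply hdist_ge0 | apply arcosh_ge0; nra |].
rewrite cosh_arcosh, cosh_hdist by nra.
pose proof (cosh_sinh_sqr u) as E; rewrite (Hcs u Hu) in E.
pose proof (exp_pos s).
assert (Es : / exp s + exp s = 2 * cosh t)
  by (rewrite <- (Hcs s Hs); unfold cosh; rewrite exp_Ropp; lra).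
unfold mink; simpl; rewrite (Hcs u Hu).
transitivity ((/ exp s * ((sinh u ^ 2 + 1) / cosh t) + exp s * cosh t) / 2);
  [field; lra |].
replace (sinh u ^ 2 + 1) with (cosh t ^ 2) by lra.
transitivity ((/ exp s + exp s) * cosh t / 2); [field; lra |].
rewrite Es; field.
Qed.

Lemma gamma_attained (x : R) : 0 <= x ->
  exists a b c d : H2, quad_diam hdist a b c d = x /\ gamma x = quad_delta hdist a b c d.
Proof.
intros Hx; set (t := x / 2).
exists (square_top t), (square_side t), (square_top (- t)), (square_side (- t)).
assert (Ht : 0 <= t) by (unfold t; lra).
destruct (hdist_square_diagonals t Ht) as [E1 E2].
pose proof (Rabs_pos_eq t Ht) as A1; assert (A2 : Rabs (- t) = t) by now rewrite Rabs_Ropp.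
pose proof (hdist_square_sides t t t Ht A1 A1) as E3.
pose proof (hdist_square_sides t t (- t) Ht A1 A2) as E4.
pose proof (hdist_square_sides t (- t) t Ht A2 A1) as E5.
pose proof (hdist_square_sides t (- t) (- t) Ht A2 A2) as E6.
pose proof (gamma_ge0 x Hx) as G; unfold gamma in G |- *; fold t in G |- *.
pose proof (arcosh_ge0 (cosh t ^ 2)) as P.
assert (P' : 0 <= arcosh (cosh t ^ 2)) by (apply P; pose proof (cosh_ge1 t); nra).
unfold quad_diam, quad_delta, mid3, max3, min3.
rewrite (hdist_sym (square_side t) (square_top (- t))), E1, E2, E3, E4, E5, E6.
replace (2 * t) with x by (unfold t; field).
set (w := arcosh (cosh t ^ 2)) in *.
split; unfold Rmax, Rmin; repeat destruct (Rle_dec _ _); lra.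
Qed.

Lemma Gamma_hdist (x : R) : 0 <= x -> Gamma hdist x = Finite (gamma x).
Proof.
intros Hx; apply is_lub_Rbar_unique; split.
- intros v [a [b [c [d [<- ->]]]]]; apply quad_delta_le.
- intros l Hl; apply Hl, gamma_attained, Hx.
Qed.

(** * Derivatives of the closed form *)

Lemma is_derive_arcosh (u : R) : 1 < u -> is_derive arcosh u (/ sqrt (u ^ 2 - 1)).
Proof.
intros Hu; unfold arcosh.
assert (Hq : 0 < u ^ 2 - 1) by nra.
pose proof (sqrt_lt_R0 _ Hq) as Hs.
auto_derive; replace (u * (u * 1) + - (1)) with (u ^ 2 - 1) by ring.
- repeat split; lra.
- field; lra.
Qed.

Definition gamma' (x : R) : R := 1 - cosh (x / 2) / sqrt (cosh (x / 2) ^ 2 + 1).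

Lemma is_derive_cosh_half (x : R) :
  is_derive (fun t => cosh (t / 2)) x (sinh (x / 2) / 2).
Proof. unfold cosh, sinh; auto_derive; trivial; unfold Rdiv; field. Qed.

Lemma is_derive_gamma (x : R) : 0 < x -> is_derive gamma x (gamma' x).
Proof.
intros Hx; set (c := cosh (x / 2)); set (s := sinh (x / 2)).
assert (Hs : 0 < s) by (apply sinh_pos; lra).
assert (Hc : c ^ 2 - s ^ 2 = 1) by apply cosh_sinh_sqr.
assert (Hq : 0 < sqrt (c ^ 2 + 1)) by (apply sqrt_lt_R0; nra).
assert (Hsqrt : sqrt ((c ^ 2) ^ 2 - 1) = s * sqrt (c ^ 2 + 1)).
{ replace ((c ^ 2) ^ 2 - 1) with (s ^ 2 * (c ^ 2 + 1))
    by (replace (s ^ 2) with (c ^ 2 - 1) by lra; ring).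
  pose proof (pow2_ge_0 s); pose proof (pow2_ge_0 c).
  rewrite sqrt_mult by lra; rewrite sqrt_pow2 by lra; reflexivity. }
assert (D : is_derive (fun t => arcosh (cosh (t / 2) ^ 2)) x (c / sqrt (c ^ 2 + 1))).
{ replace (c / sqrt (c ^ 2 + 1)) with (scal (s / 2 * (2 * c)) (/ sqrt ((c ^ 2) ^ 2 - 1)))
    by (rewrite Hsqrt; change (s / 2 * (2 * c) * / (s * sqrt (c ^ 2 + 1)) = c / sqrt (c ^ 2 + 1));
        field; lra).
  apply (is_derive_comp (K := R_AbsRing) arcosh (fun t => cosh (t / 2) ^ 2));
    [apply is_derive_arcosh; fold c; nra |].
  apply (is_derive_comp (K := R_AbsRing) (fun u => u ^ 2) (fun t => cosh (t / 2)));
    [auto_derive; trivial; fold c; ring | apply is_derive_cosh_half]. }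
apply (is_derive_minus (K := R_AbsRing) (V := R_NormedModule) (fun t => t));
  [apply (is_derive_id (K := R_AbsRing)) | exact D].
Qed.

Lemma is_derive_gamma' (x : R) :
  is_derive gamma' x
    (- (sinh (x / 2) / 2 / ((cosh (x / 2) ^ 2 + 1) * sqrt (cosh (x / 2) ^ 2 + 1)))).
Proof.
set (c := cosh (x / 2)); set (s := sinh (x / 2)).
assert (Hc : 0 < c ^ 2 + 1) by nra.
pose proof (sqrt_lt_R0 _ Hc) as Hq; pose proof (pow2_sqrt _ (Rlt_le _ _ Hc)) as Eq.
replace (- _) with (scal (s / 2) (- (/ ((c ^ 2 + 1) * sqrt (c ^ 2 + 1)))))
  by (change (s / 2 * - (/ ((c ^ 2 + 1) * sqrt (c ^ 2 + 1)))
              = - (s / 2 / ((c ^ 2 + 1) * sqrt (c ^ 2 + 1)))); field; lra).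
apply (is_derive_comp (K := R_AbsRing) (fun u => 1 - u / sqrt (u ^ 2 + 1))
  (fun t => cosh (t / 2)));
  [| apply is_derive_cosh_half].
fold c; auto_derive; replace (c * (c * 1) + 1) with (c ^ 2 + 1) by ring.
- repeat split; lra.
- set (q := sqrt (c ^ 2 + 1)) in *.
  transitivity (- ((q ^ 2 - c ^ 2) / (q ^ 2 * q))); [field; lra |].
  rewrite Eq; replace (c ^ 2 + 1 - c ^ 2) with 1 by ring; field; lra.
Qed.

Lemma gamma'_ge0 (x : R) : 0 <= gamma' x.
Proof.
unfold gamma'; set (c := cosh (x / 2)).
assert (Hc : 0 < c ^ 2 + 1) by nra.
pose proof (sqrt_lt_R0 _ Hc) as Hq.
enough (c / sqrt (c ^ 2 + 1) <= 1) by lra.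
apply Rle_div_l; [exact Hq |]; rewrite Rmult_1_l.
apply Rsqr_incr_0_var; [| lra]; rewrite Rsqr_sqrt by lra; unfold Rsqr; lra.
Qed.

Theorem theorem3p4 :
  (forall x : R, 0 <= x ->
     Gamma hdist x = Finite (x - arcosh (cosh (x / 2) ^ 2))) /\
  (forall x : R, 0 < x ->
     let G := fun t : R => real (Gamma hdist t) in
     (ex_derive G x /\ 0 <= Derive G x) /\
     (ex_derive_n G 2 x /\ Derive_n G 2 x <= 0)).
Proof.
split; [exact Gamma_hdist |].
intros x Hx G.
assert (D1 : forall t, 0 < t -> is_derive G t (gamma' t)).
{ intros t Ht; apply (is_derive_ext_loc gamma); [| now apply is_derive_gamma].
  apply (locally_interval _ t 0 p_infty); simpl; trivial.
  intros u Hu _; unfold G; rewrite Gamma_hdist; [reflexivity | now apply Rlt_le]. }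
assert (D2 : is_derive (Derive G) x
  (- (sinh (x / 2) / 2 / ((cosh (x / 2) ^ 2 + 1) * sqrt (cosh (x / 2) ^ 2 + 1))))).
{ apply (is_derive_ext_loc gamma'); [| apply is_derive_gamma'].
  apply (locally_interval _ x 0 p_infty); simpl; trivial.
  intros u Hu _; symmetry; now apply is_derive_unique, D1. }
split; split.
- exists (gamma' x); now apply D1.
- rewrite (is_derive_unique _ _ _ (D1 x Hx)); apply gamma'_ge0.
- eexists; exact D2.
- change (Derive (Derive G) x <= 0); rewrite (is_derive_unique _ _ _ D2).
  assert (Hs : 0 < sinh (x / 2)) by (apply sinh_pos; lra).
  assert (Hc : 0 < cosh (x / 2) ^ 2 + 1) by nra.
  apply Rge_le, Ropp_0_le_ge_contravar, Rdiv_le_0_compat; [lra |].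
  apply Rmult_lt_0_compat; [exact Hc | now apply sqrt_lt_R0].
Qed.
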